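(* For $n=1,2,\ldots$ let $$Q_n=\left\{(x,y)\in\mathbb R^2:\ 0<\frac{nx+y}{2}<\pi,\ -\frac{\pi}{2}<\frac{nx-y}{2}<\frac{\pi}{2}\right\}.$$ Then $(Q_n)$ is a sequence of domains in $\mathbb R^2$ that collapse to a segment (so that they collapse to a set of zero measure and are narrower and narrower), and yet the principal eigenvalue $\mu_1^-(Q_n)$ of $\mathcal{P}^-_{1}$ stays bounded above by $1$: $$\mu_1^-(Q_n)\leq 1 \quad\text{for every } n.$$
   Context: For a real symmetric $2\times2$ matrix $X$, $\mathcal{P}^-_{1}(X)=\lambda_1(X)$ denotes its smallest eigenvalue. For a domain $\Omega\subset\mathbb R^2$, $$\mu_1^-(\Omega)=\sup\{\mu\in\mathbb R:\ \exists\,\phi\in USC(\Omega),\ \phi<0,\ \text{such that } \mathcal{P}^-_{1}(D^2\phi)+\mu\phi\geq 0\ \text{in }\Omega\},$$ where $USC(\Omega)$ is the set of upper semicontinuous functions on $\Omega$ and the differential inequality is understood in the viscosity sense: whenever $\varphi\in C^2(\Omega)$ and $\phi-\varphi$ has a local maximum at $\hat x\in\Omega$, one has $\mathcal{P}^-_{1}(D^2\varphi(\hat x))+\mu\phi(\hat x)\geq 0$. The phrase ''collapse to a segment'' (as $n\to\infty$) is used informally. *)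

(* Defs.v *)
From HB Require Import structures.
From mathcomp Require Import all_boot all_order all_algebra.
From mathcomp Require Import all_classical all_reals all_analysis.
Set Implicit Arguments.
Unset Strict Implicit.
Unset Printing Implicit Defensive.
Import Order.TTheory GRing.Theory Num.Theory.
Import numFieldNormedType.Exports.
Local Open Scope classical_set_scope.
Local Open Scope ring_scope.

(* The plane is R * R: its library norm is the sup norm, which induces the
   usual topology; the Euclidean structure is given by dotp and eudist below. *)

Definition domain (R : realType) (Omega : set (R * R)) : Prop :=
  [/\ open Omega, connected Omega & Omega !=set0].

(* On symmetric 2x2 matrices, the only ones to which it is applied, the set of
   eigenvalues is finite and nonempty, so that inf is its least element. *)
Definition P1minus (R : realType) (X : 'M[R]_2) : R :=
  inf [set a : R | eigenvalue X a].

Definition unitvec (R : realType) (i : 'I_2) : R * R :=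
  if i == 0 then (1, 0) else (0, 1).

Definition partial (R : realType) (i : 'I_2) (f : R * R -> R) (p : R * R) : R :=
  'D_(unitvec R i) (f : R * R -> R^o) p.

Definition partial_ex (R : realType) (i : 'I_2) (f : R * R -> R) (p : R * R)
  : Prop := derivable (f : R * R -> R^o) p (unitvec R i).

Definition Hessian (R : realType) (f : R * R -> R) (p : R * R) : 'M[R]_2 :=
  \matrix_(i, j) partial j (partial i f) p.

(* C^2 on an open set Omega. Functions on Omega are represented by total
   functions on the plane, whose values outside Omega are irrelevant. *)
Definition C2 (R : realType) (Omega : set (R * R)) (f : R * R -> R) : Prop :=
  forall p, Omega p ->
    [/\ {for p, continuous f},
        forall i, partial_ex i f p /\ {for p, continuous (partial i f)} &
        forall i j, partial_ex j (partial i f) p /\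
                    {for p, continuous (partial j (partial i f))}].

Definition USC (R : realType) (Omega : set (R * R)) (f : R * R -> R) : Prop :=
  forall p, Omega p -> forall a, f p < a ->
    \forall q \near within Omega (nbhs p), f q < a.

Definition local_max (R : realType) (Omega : set (R * R)) (f : R * R -> R)
    (p : R * R) : Prop :=
  Omega p /\ \forall q \near within Omega (nbhs p), f q <= f p.

(* P1minus (D^2 phi) + mu * phi >= 0 in Omega, in the viscosity sense. *)
Definition viscosity_ge0 (R : realType) (Omega : set (R * R)) (mu : R)
    (phi : R * R -> R) : Prop :=
  forall (psi : R * R -> R) (p : R * R), C2 Omega psi ->
    local_max Omega (fun q => phi q - psi q) p ->
    0 <= P1minus (Hessian psi p) + mu * phi p.

(* The supremum is taken in the extended reals, so that an upper bound on mu1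
   is a genuine bound on every admissible mu. *)
Definition mu1 (R : realType) (Omega : set (R * R)) : \bar R :=
  ereal_sup [set mu%:E | mu in [set mu : R | exists phi : R * R -> R,
    [/\ USC Omega phi,
        forall p, Omega p -> phi p < 0 &
        viscosity_ge0 Omega mu phi]]].

Definition Q (R : realType) (n : nat) : set (R * R) :=
  [set p | 0 < (n%:R * p.1 + p.2) / 2 < pi /\
           - (pi / 2) < (n%:R * p.1 - p.2) / 2 < pi / 2].
Arguments Q : clear implicits.

Definition dotp (R : realType) (p q : R * R) : R := p.1 * q.1 + p.2 * q.2.

Definition eudist (R : realType) (p q : R * R) : R :=
  Num.sqrt (dotp (p - q) (p - q)).

Definition thickening (R : realType) (A : set (R * R)) (e : R) : set (R * R) :=
  [set p | exists2 q, A q & eudist p q < e].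

(* Convergence in the Hausdorff distance. *)
Definition collapse_to (R : realType) (A : nat -> set (R * R))
    (S : set (R * R)) : Prop :=
  forall e : R, 0 < e ->
    \forall n \near \oo, A n `<=` thickening S e /\ S `<=` thickening (A n) e.

Definition segment (R : realType) (a b : R * R) : set (R * R) :=
  [set (1 - t) *: a + t *: b | t in `[0, 1]].

Definition area (R : realType) (A : set (R * R)) : \bar R :=
  ((@lebesgue_measure R) \x (@lebesgue_measure R))%E A.

(* The infimum of the widths of the strips containing A: the extent of A in
   the unit direction e, minimized over e. *)
Definition width (R : realType) (A : set (R * R)) : \bar R :=
  ereal_inf [set ereal_sup [set (dotp e (p.1 - p.2))%:E | p in A `*` A]
            | e in [set e : R * R | dotp e e = 1]].

(* Main.v *)
Require Import Defs.
From mathcomp Require Import all_boot all_order all_algebra.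
From mathcomp Require Import all_classical all_reals all_analysis.
From mathcomp Require Import ring lra.
Import Order.TTheory GRing.Theory Num.Theory.
Import numFieldNormedType.Exports.
Local Open Scope classical_set_scope.
Local Open Scope ring_scope.
Set Implicit Arguments.
Unset Strict Implicit.
Unset Printing Implicit Defensive.

(* Q n is the open rhombus with center (pi / 2n, pi / 2), horizontal half
   diagonal pi / n and vertical half diagonal pi; all the geometric claims
   follow from this.  For the eigenvalue bound, Q n contains a closed rectangle
   [al, be] x [0, pi].  Put g (x, y) = (x - al) (be - x) sin y, which is
   positive inside the rectangle and zero on its boundary, with g_yy = - g.
   For an admissible phi, the quotient g / - phi is upper semicontinuous on the
   rectangle, hence is maximal at a point p, which is interior.  Thus
   psi = - t g, for a suitable t > 0, touches phi from above at p, and the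
   smallest eigenvalue of D^2 psi (p) is at most
   psi_yy (p) = t g (p) = - phi (p).  Hence 0 <= (mu - 1) phi (p), and mu <= 1
   because phi (p) < 0. *)

(** * The smallest eigenvalue of a symmetric 2x2 matrix *)

Lemma eigenvalue_mx22 (R : realType) (X : 'M[R]_2) (a : R) :
  eigenvalue X a = ((a - X 0 0) * (a - X 1 1) == X 0 1 * X 1 0).
Proof.
rewrite eigenvalue_root_char rootE /char_poly (expand_det_row _ 0).
rewrite !big_ord_recl big_ord0 /cofactor !det_mx11 !mxE /= addr0.
rewrite !hornerE /=.
have -> : lift 0 0 = 1 :> 'I_2 by apply/val_inj.
have -> : lift 1 0 = 0 :> 'I_2 by apply/val_inj.
rewrite -[RHS]subr_eq0.
rewrite ?mulr0n ?mulr1n /= ?hornerE /= ?expr0 ?expr1.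
congr (_ == _); ring.
Qed.

(** The smaller root of the characteristic polynomial is [(a + d - s) / 2], with [s] the root of the
    discriminant, and [s >= |a - d|]. *)
Lemma P1minus_le_diag (R : realType) (X : 'M[R]_2) :
  X 0 1 = X 1 0 -> P1minus X <= X 1 1.
Proof.
move=> Xsym; set a := X 0 0; set d := X 1 1; set b := X 0 1.
set s := Num.sqrt ((a - d) ^+ 2 + 4 * b ^+ 2).
have D0 : 0 <= (a - d) ^+ 2 + 4 * b ^+ 2.
  by rewrite addr_ge0 ?sqr_ge0 // mulr_ge0 ?sqr_ge0 ?ler0n.
have s2 : s ^+ 2 = (a - d) ^+ 2 + 4 * b ^+ 2 by rewrite sqr_sqrtr.
have s0 : 0 <= s by rewrite sqrtr_ge0.
have eig c : eigenvalue X c = ((c - a) * (c - d) == b ^+ 2).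
  by rewrite eigenvalue_mx22 -Xsym expr2.
have ads : `|a - d| <= s.
  by rewrite -(@ler_pXn2r _ 2) ?nnegrE // real_normK ?num_real // s2 lerDl
     mulr_ge0 ?sqr_ge0 ?ler0n.
apply: (@le_trans _ _ ((a + d - s) / 2)); last first.
  by move: ads; rewrite ler_norml; lra.
apply: ge_inf; last first.
  by rewrite /= eig; apply/eqP; move: s2; rewrite !expr2; lra.
(* A lower bound is needed for [inf] to be meaningful: an eigenvalue [c] below this root would
   satisfy [s ^+ 2 < (a + d - 2 * c) ^+ 2], whereas the characteristic equation makes the two sides
   equal. *)
exists ((a + d - s) / 2) => c /=; rewrite eig => /eqP cE.
rewrite leNgt; apply/negP => clt.
have : s ^+ 2 < (a + d - 2 * c) ^+ 2.
  by rewrite ltr_pXn2r ?nnegrE //; lra.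
by rewrite s2; move: cE; rewrite !expr2; lra.
Qed.

(** * Partial derivatives and functions with separated variables *)

Lemma scale_unitvecD0 (R : realType) (k : R) (p : R * R) :
  k *: unitvec R 0 + p = (k *: 1 + p.1, p.2) :> R * R.
Proof. by case: p => x y; rewrite /unitvec eqxx; congr pair; rewrite /= scaler0 add0r. Qed.

Lemma scale_unitvecD1 (R : realType) (k : R) (p : R * R) :
  k *: unitvec R 1 + p = (p.1, k *: 1 + p.2) :> R * R.
Proof. by case: p => x y; rewrite /unitvec; congr pair; rewrite /= scaler0 add0r. Qed.

(** The difference quotient of [f] along the unit vector coincides with that of its one-variable
    slice. *)
Lemma is_derive_unitvec0 (R : realType) (f : R * R -> R) (p : R * R) (l : R) :
  is_derive p.1 1 ((fun x => f (x, p.2)) : R -> R^o) l ->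
  is_derive p (unitvec R 0) (f : R * R -> R^o) l.
Proof.
have E : (fun k : R => k^-1 *: (((f : R * R -> R^o) \o shift p) (k *: unitvec R 0) - f p))
   = (fun k : R => k^-1 *: (((((fun x => f (x, p.2)) : R -> R^o)) \o shift p.1) (k *: (1 : R)) - f (p.1, p.2))).
  by apply/funext => k; rewrite /= scale_unitvecD0 -surjective_pairing.
by case=> dx <-; split; rewrite /derivable /derive E.
Qed.

Lemma is_derive_unitvec1 (R : realType) (f : R * R -> R) (p : R * R) (l : R) :
  is_derive p.2 1 ((fun y => f (p.1, y)) : R -> R^o) l ->
  is_derive p (unitvec R 1) (f : R * R -> R^o) l.
Proof.
have E : (fun k : R => k^-1 *: (((f : R * R -> R^o) \o shift p) (k *: unitvec R 1) - f p))
   = (fun k : R => k^-1 *: (((((fun y => f (p.1, y)) : R -> R^o)) \o shift p.2) (k *: (1 : R)) - f (p.1, p.2))).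
  by apply/funext => k; rewrite /= scale_unitvecD1 -surjective_pairing.
by case=> dx <-; split; rewrite /derivable /derive E.
Qed.

(** Each partial derivative acts on a single factor and yields another such product, so regularity
    and Hessian reduce to one-variable calculus. *)
Definition tensor (R : realType) (f g : R -> R) (q : R * R) : R :=
  f q.1 * g q.2.

Lemma is_derive0_tensor (R : realType) (f f' g : R -> R) (p : R * R) :
  (forall x : R, is_derive x 1 (f : R -> R^o) (f' x)) ->
  is_derive p (unitvec R 0) (tensor f g : R * R -> R^o) (tensor f' g p).
Proof.
move=> df; apply: is_derive_unitvec0; rewrite /tensor /=.
have := @is_deriveM _ _ f (cst (g p.2)) p.1 1 _ _ (df p.1) (is_derive_cst _ _ _).
by rewrite scaler0 add0r [_ *: _]mulrC; apply.
Qed.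

Lemma is_derive1_tensor (R : realType) (f g g' : R -> R) (p : R * R) :
  (forall x : R, is_derive x 1 (g : R -> R^o) (g' x)) ->
  is_derive p (unitvec R 1) (tensor f g : R * R -> R^o) (tensor f g' p).
Proof.
move=> dg; apply: is_derive_unitvec1; rewrite /tensor /=.
have := @is_deriveM _ _ (cst (f p.1)) g p.2 1 _ _ (is_derive_cst _ _ _) (dg p.2).
by rewrite scaler0 addr0; apply.
Qed.

Lemma continuous_tensor (R : realType) (f g : R -> R) :
  continuous f -> continuous g -> continuous (tensor f g).
Proof.
move=> cf cg p; apply: cvgM.
- by apply: (cvg_comp _ _ cvg_fst); apply: cf.
- by apply: (cvg_comp _ _ cvg_snd); apply: cg.
Qed.

Section tensor_C2.
Variables (R : realType) (f f' f'' g g' g'' : R -> R).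
Hypothesis df : forall x : R, is_derive x 1 (f : R -> R^o) (f' x).
Hypothesis df' : forall x : R, is_derive x 1 (f' : R -> R^o) (f'' x).
Hypothesis dg : forall x : R, is_derive x 1 (g : R -> R^o) (g' x).
Hypothesis dg' : forall x : R, is_derive x 1 (g' : R -> R^o) (g'' x).
Hypotheses (cf'' : continuous f'') (cg'' : continuous g'').

Let cdiff (u u' : R -> R) :
  (forall x : R, is_derive x 1 (u : R -> R^o) (u' x)) -> continuous u.
Proof.
move=> du x; apply: differentiable_continuous.
by apply/derivable1_diffP; have [] := du x.
Qed.

Let cf := cdiff df.
Let cf' := cdiff df'.
Let cg := cdiff dg.
Let cg' := cdiff dg'.

Lemma partial0_tensor u u' v :
  (forall x : R, is_derive x 1 (u : R -> R^o) (u' x)) ->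
  partial 0 (tensor u v) = tensor u' v.
Proof. by move=> du; apply/funext => p; have [] := is_derive0_tensor v p du. Qed.

Lemma partial1_tensor u v v' :
  (forall x : R, is_derive x 1 (v : R -> R^o) (v' x)) ->
  partial 1 (tensor u v) = tensor u v'.
Proof. by move=> dv; apply/funext => p; have [] := is_derive1_tensor u p dv. Qed.

Let ord2E (i : 'I_2) : i = 0 \/ i = 1.
Proof. by case: i => [[|[|//]] ?]; [left|right]; apply/val_inj. Qed.

Lemma C2_tensor Omega : C2 Omega (tensor f g).
Proof.
have ex0 u u' v p : (forall x : R, is_derive x 1 (u : R -> R^o) (u' x)) ->
  partial_ex 0 (tensor u v) p.
  by move=> du; have [] := is_derive0_tensor v p du.
have ex1 u v v' p : (forall x : R, is_derive x 1 (v : R -> R^o) (v' x)) ->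
  partial_ex 1 (tensor u v) p.
  by move=> dv; have [] := is_derive1_tensor u p dv.
move=> p _; split; first by apply: continuous_tensor.
- move=> i; case: (ord2E i) => ->.
    rewrite (partial0_tensor _ df); split; first exact: ex0 df.
    by apply: continuous_tensor.
  rewrite (partial1_tensor _ dg); split; first exact: ex1 dg.
  by apply: continuous_tensor.
- move=> i j; case: (ord2E i) => ->; case: (ord2E j) => ->.
  + rewrite (partial0_tensor _ df) (partial0_tensor _ df').
    by split; [exact: ex0 df'|apply: continuous_tensor].
  + rewrite (partial0_tensor _ df) (partial1_tensor _ dg).
    by split; [exact: ex1 dg|apply: continuous_tensor].
  + rewrite (partial1_tensor _ dg) (partial0_tensor _ df).
    by split; [exact: ex0 df|apply: continuous_tensor].
  + rewrite (partial1_tensor _ dg) (partial1_tensor _ dg').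
    by split; [exact: ex1 dg'|apply: continuous_tensor].
Qed.

(** Both mixed derivatives equal [tensor f' g'], so the Hessian is symmetric and the bound by its
    yy-entry applies. *)
Lemma P1minus_Hessian_tensor p : P1minus (Hessian (tensor f g) p) <= f p.1 * g'' p.2.
Proof.
have H11 : Hessian (tensor f g) p 1 1 = f p.1 * g'' p.2.
  by rewrite mxE (partial1_tensor _ dg) (partial1_tensor _ dg').
rewrite -H11 P1minus_le_diag // !mxE (partial1_tensor _ dg).
by rewrite (partial0_tensor _ df) (partial0_tensor _ df) (partial1_tensor _ dg).
Qed.
End tensor_C2.

(** * Maxima of upper semicontinuous functions on compact sets *)

(** The superlevel sets [B q] are nested and nonempty, so they generate a proper filter, which has a
    cluster point [p]. Without a maximum some [q] has [F p < F q]; then [F < F q] on [K] near [p],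
    so [B q] misses a neighbourhood of [p]. *)
Lemma usc_compact_max (R : realType) (T : topologicalType) (K : set T)
    (F : T -> R) :
  compact K -> K !=set0 ->
  (forall p, K p -> forall a, F p < a -> \forall q \near within K (nbhs p), F q < a) ->
  exists2 p, K p & forall q, K q -> F q <= F p.
Proof.
move=> cK [k0 Kk0] uscF; apply: contrapT => nomax.
have lt_ex p : K p -> exists2 q, K q & F p < F q.
  move=> Kp; apply: contrapT => H; apply: nomax; exists p => // q Kq.
  by rewrite leNgt; apply/negP => pq; apply: H; exists q.
pose B q := [set x | K x /\ F q <= F x].
have FB : ProperFilter (filter_from K B).
  apply: filter_from_proper; last by move=> q Kq; exists q; split.
  apply: filter_from_filter; first by exists k0.
  move=> p q Kp Kq; case: (leP (F p) (F q)) => pq.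
    by exists q => // x [Kx qx]; split; split=> //; apply: le_trans qx.
  by exists p => // x [Kx px]; split; split=> //; apply: le_trans px; apply: ltW.
have [|p [Kp clp]] := cK _ FB; first by exists k0 => // x [].
have [q Kq pq] := lt_ex p Kp.
have [|x [[Kx qx]]] := clp (B q) _ _ (uscF p Kp _ pq); first by exists q.
by move=> /(_ Kx); rewrite ltNge qx.
Qed.

(** * The rhombus as an open connected set *)

Lemma QP (R : realType) (n : nat) (p : R * R) :
  Q R n p <-> [/\ 0 < n%:R * p.1 + p.2, n%:R * p.1 + p.2 < 2 * pi,
                 - pi < n%:R * p.1 - p.2 & n%:R * p.1 - p.2 < pi].
Proof.
rewrite /Q /=; split.
  by move=> [/andP[? ?] /andP[? ?]]; split; lra.
by move=> [? ? ? ?]; split; apply/andP; split; lra.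
Qed.

Definition Qcenter (R : realType) (n : nat) : R * R := (pi / 2 / n%:R, pi / 2).

Lemma mul_Qcenter1 (R : realType) n : (1 <= n)%N -> n%:R * (Qcenter R n).1 = pi / 2.
Proof. by move=> n0; rewrite /= mulrC divfK // pnatr_eq0 -lt0n. Qed.

(* In units of its half diagonals [pi / n] and [pi], Q n is an open l1-ball. *)
Lemma Q_from_center (R : realType) n (a b : R) : (1 <= n)%N ->
  `|n%:R * a| + `|b| < pi -> Q R n (Qcenter R n + (a, b)).
Proof.
move=> n1 ab; apply/QP.
have -> : n%:R * (Qcenter R n + (a, b)).1 = pi / 2 + n%:R * a.
  by rewrite mulrDr mul_Qcenter1.
have -> : (Qcenter R n + (a, b)).2 = pi / 2 + b by [].
have := ler_norm (n%:R * a); have := ler_norm b.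
have := ler_norm (- (n%:R * a)); have := ler_norm (- b); rewrite !normrN.
by move=> *; split; lra.
Qed.

Lemma Q_preimage (R : realType) (n : nat) :
  Q R n = (fun p : R * R => n%:R * p.1 + p.2) @^-1` `]0, 2 * pi[ `&`
          (fun p : R * R => n%:R * p.1 - p.2) @^-1` `]- pi, pi[.
Proof.
apply/seteqP; split => p; rewrite QP /= !in_itv /=.
  by move=> [-> -> -> ->].
by move=> [/andP[? ?] /andP[? ?]].
Qed.

Lemma open_Q (R : realType) n : open (Q R n).
Proof.
have cx : continuous (fun p : R * R => n%:R * p.1 + p.2).
  move=> p; apply: cvgD; last exact: cvg_snd.
  by apply: cvgM; [exact: cvg_cst|exact: cvg_fst].
have cy : continuous (fun p : R * R => n%:R * p.1 - p.2).
  move=> p; apply: cvgB; last exact: cvg_snd.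
  by apply: cvgM; [exact: cvg_cst|exact: cvg_fst].
rewrite Q_preimage.
apply: openI.
- by move/continuousP: cx; apply; exact: interval_open.
- by move/continuousP: cy; apply; exact: interval_open.
Qed.

(** Each of the four defining inequalities asserts that an affine function is positive, which passes
    to convex combinations. *)
Lemma Q_convex (R : realType) (n : nat) (p q : R * R) (t : R) : 0 <= t <= 1 ->
  Q R n p -> Q R n q -> Q R n ((1 - t) *: p + t *: q).
Proof.
case: p q => [p1 p2] [q1 q2] /andP[t0 t1].
have {}t1 : 0 <= 1 - t by lra.
have conv (x y : R) : 0 < x -> 0 < y -> 0 < (1 - t) * x + t * y.
  move=> x0 y0; have [->|tp] := eqVneq t 0; first by rewrite subr0 mul1r mul0r addr0.
  by rewrite ltr_wpDl ?(mulr_ge0 t1 (ltW x0)) // mulr_gt0 // lt0r tp.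
have sub0 (x y : R) : x < y -> 0 < y - x by rewrite subr_gt0.
rewrite !QP; move: pi => w /= [b1 b2 b3 b4] [a1 a2 a3 a4].
have := conv _ _ b1 a1; have := conv _ _ (sub0 _ _ b2) (sub0 _ _ a2).
have := conv _ _ (sub0 _ _ b3) (sub0 _ _ a3); have := conv _ _ (sub0 _ _ b4) (sub0 _ _ a4).
rewrite /GRing.scale /= => *; split; lra.
Qed.

Lemma Qcenter_in (R : realType) (n : nat) : (1 <= n)%N -> Q R n (Qcenter R n).
Proof.
move=> n1; rewrite -[Qcenter R n]addr0; apply: Q_from_center => //.
by rewrite mulr0 normr0 addr0 pi_gt0.
Qed.

(** By convexity the set is a union of segments issuing from the center, each a continuous image of
    [[0, 1]]. *)
Lemma connected_Q (R : realType) n : (1 <= n)%N -> connected (Q R n).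
Proof.
move=> n1; pose seg (p : R * R) := (fun t : R => (1 - t) *: Qcenter R n + t *: p) @` `[0, 1].
have Qc := Qcenter_in R n1.
have -> : Q R n = \bigcup_(p in Q R n) seg p.
  apply/seteqP; split => [p Qp|q [p Qp [t]]].
    by exists p => //; exists 1; rewrite /= ?in_itv /= ?lexx ?ler01 // subrr scale0r scale1r add0r.
  by rewrite /= in_itv /= => t01 <-; apply: Q_convex.
apply: bigcup_connected.
  by exists (Qcenter R n) => p Qp; exists 0; rewrite /= ?in_itv /= ?lexx ?ler01 // subr0 scale0r scale1r addr0.
move=> p Qp; apply: connected_continuous_connected; first exact: segment_connected.
apply: continuous_subspaceT => t; apply: cvgD.
  by apply: cvgZr_tmp; apply: cvgB; [exact: cvg_cst|exact: cvg_id].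
by apply: cvgZr_tmp; exact: cvg_id.
Qed.

(** * The bound on the principal eigenvalue *)

(** The rectangle may be arbitrarily thin: the bound uses only the second y-derivative of the
    barrier, and the height [pi] alone fixes the constant 1. *)
Lemma mu_le1_of_rectangle (R : realType) (Omega : set (R * R)) (mu al be : R)
    (phi : R * R -> R) : al < be -> `[al, be] `*` `[0, pi] `<=` Omega ->
  USC Omega phi -> (forall p, Omega p -> phi p < 0) ->
  viscosity_ge0 Omega mu phi -> mu <= 1.
Proof.
move=> ab; set K := (_ `*` _) => KO uscphi phi0 visc.
pose f (x : R) := (x - al) * (be - x).
pose g := tensor f (@sin R).
have cf : continuous f.
  move=> x; apply: cvgM; apply: cvgB; by [exact: cvg_cst|exact: cvg_id].
have cg : continuous g by apply: continuous_tensor => //; exact: continuous_sin.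
have pi0 := pi_gt0 R.
have m0 : K ((al + be) / 2, pi / 2).
  by split; rewrite /= in_itv /=; apply/andP; split; lra.
have gm0 : 0 < g ((al + be) / 2, pi / 2).
  by rewrite /g /tensor /= sin_pihalf mulr1 mulr_gt0 //; lra.
have [|||p Kp pmax] := @usc_compact_max R _ K (fun q => g q / - phi q).
- by apply: compact_setX; exact: segment_compact.
- by exists ((al + be) / 2, pi / 2).
- move=> q Kq a; have fq0 := phi0 _ (KO _ Kq).
  have pos x : K x -> 0 < - phi x by move=> Kx; rewrite oppr_gt0 phi0 //; exact: KO.
  rewrite ltr_pdivrMr ?pos // => lt.
  have g0 x : K x -> 0 <= g x.
    move=> [] /=; rewrite !in_itv /= => /andP[x1 x2] x3.
    by rewrite mulr_ge0 ?sin_ge0_pi ?mulr_ge0 ?subr_ge0.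
  have a0 : 0 < a.
    by have := le_lt_trans (g0 _ Kq) lt; rewrite pmulr_lgt0 // pos.
  (* The midpoint of [g q / a] and [- phi q] separates numerator from denominator: near [q], [g]
     stays below [b * a] by continuity and [- phi] above [b] by semicontinuity. *)
  pose b := (g q / a - phi q) / 2.
  have gb : g q / a < b.
    by move: lt; rewrite mulrC -ltr_pdivrMr // /b; lra.
  have pb : phi q < - b.
    by move: lt; rewrite mulrC -ltr_pdivrMr // /b; lra.
  have ng : \forall x \near nbhs q, g x < b * a.
    have := cg q; move/cvgr_lt; apply.
    by rewrite -ltr_pdivrMr.
  have nphi : nbhs q (fun x => Omega x -> phi x < - b) := uscphi q (KO _ Kq) _ pb.
  move: ng nphi; apply: filterS2 => x gx phx Kx; rewrite ltr_pdivrMr ?pos //.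
  by rewrite (lt_trans gx) // mulrC ltr_pM2l // ltrNr phx //; exact: KO.
have fp0 := phi0 _ (KO _ Kp).
(* The maximum of the quotient is at least its value at the middle of the rectangle, which is
   positive. *)
have gp0 : 0 < g p.
  have := pmax _ m0; rewrite ler_pdivlMr ?oppr_gt0 // => le.
  have := phi0 _ (KO _ m0) => fm0.
  rewrite ltNge; apply/negP => gp.
  have : 0 < g ((al + be) / 2, pi / 2) / - phi ((al + be) / 2, pi / 2) * - phi p.
    by apply: mulr_gt0; [apply: divr_gt0|]; rewrite ?oppr_gt0.
  by rewrite ltNge (le_trans le gp).
have [pa pb p0 ppi] : [/\ al < p.1, p.1 < be, 0 < p.2 & p.2 < pi].
  case: Kp; rewrite /= !in_itv /= => /andP[a1 a2] /andP[a3 a4].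
  have [fp sp] : f p.1 != 0 /\ sin p.2 != 0.
    by apply/andP; rewrite -negb_or -mulf_eq0 gt_eqF.
  split; rewrite lt_neqAle ?a1 ?a2 ?a3 ?a4 andbT; apply/eqP => E.
  - by move: fp; rewrite /f E subrr mul0r eqxx.
  - by move: fp; rewrite /f E subrr mulr0 eqxx.
  - by move: sp; rewrite -E sin0 eqxx.
  - by move: sp; rewrite E sinpi eqxx.
(* This scaling makes [psi] and [phi] agree at [p]. *)
pose t := - phi p / g p.
have t0 : 0 < t by rewrite /t divr_gt0 ?oppr_gt0.
pose psi : R * R -> R := tensor (fun x => - t * f x) (@sin R).
have psiE q : psi q = - t * g q by rewrite /psi /g /tensor -mulrA.
have psip : psi p = phi p by rewrite psiE /t mulNr divfK ?opprK // gt_eqF.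
pose f1 (x : R) := - t * (al + be - 2 * x).
pose f2 (x : R) := - t * - 2.
have df (x : R) : is_derive x 1 ((fun x => - t * f x) : R -> R^o) (f1 x).
  rewrite /f; apply: is_derive_eq; rewrite /f1 /GRing.scale /=; ring.
have df1 (x : R) : is_derive x 1 (f1 : R -> R^o) (f2 x).
  rewrite /f1; apply: is_derive_eq; rewrite /f2 /GRing.scale /=; ring.
have dc (x : R) : is_derive x 1 (@cos R : R -> R^o) (- sin x) by exact: is_derive_cos.
have cf2 : continuous f2 by move=> x; exact: cvg_cst.
have cms : continuous (fun x : R => - sin x).
  by move=> x; apply: cvgN; exact: continuous_sin.
have psiC2 : C2 Omega psi by exact: (C2_tensor df df1 _ dc cf2 cms).
have lmax : local_max Omega (fun q => phi q - psi q) p.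
  split; first exact: KO.
  have nK : nbhs p K.
    exists (`]al, be[%classic, `]0, pi[%classic).
      by split; apply: near_in_itvoo; rewrite in_itv /= ?pa ?p0.
    by apply: setSX; apply: subset_itv_oo_cc.
  (* As [psi p = phi p], the claim is [phi q <= - t * g q], a rearrangement of the maximality of
     [g / - phi] at [p]. *)
  apply: filterS nK => q Kq _; rewrite psip subrr subr_le0 psiE.
  have := pmax q Kq; have := phi0 _ (KO _ Kq) => fq0.
  rewrite ler_pdivrMr ?oppr_gt0 // => le.
  rewrite mulNr lerNr /t mulrAC ler_pdivrMr //.
  move: le; rewrite mulrAC ler_pdivlMr ?oppr_gt0 //; lra.
have := visc psi p psiC2 lmax.
(* Since the second derivative of [sin] is [- sin], this bound is [- psi p], that is [- phi p]. *)
have := P1minus_Hessian_tensor df (@is_derive_sin R) dc p.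
rewrite mulrN -[_ * sin _]/(psi p) psip => le ge.
have : 0 <= (mu - 1) * phi p by lra.
by rewrite nmulr_lge0 // subr_le0.
Qed.

Lemma mu1_Q_le1 (R : realType) (n : nat) : (1 <= n)%N -> (mu1 (Q R n) <= 1%:E)%E.
Proof.
move=> n1; apply: ge_ereal_sup => _ [mu [phi [uscphi phi0 visc]] <-].
have n0 : 0 < n%:R :> R by rewrite ltr0n.
have pi0 := pi_gt0 R.
rewrite lee_fin.
(* The rectangle is centered at [Qcenter R n]; at its corners the scaled l1-distance to the center
   is [pi / 4 + pi / 2 < pi]. *)
apply: (@mu_le1_of_rectangle R (Q R n) mu (pi / 4 / n%:R) (3 * pi / 4 / n%:R) phi) => //.
  rewrite ltr_pM2r ?invr_gt0 //; lra.
move=> p [] /=; rewrite !in_itv /= => /andP[a b] /andP[c d]; apply/QP.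
move: a b; rewrite ler_pdivrMr // ler_pdivlMr // => a b.
split; lra.
Qed.

(** * Collapse to a vertical segment *)

Lemma eudist_le (R : realType) (p q : R * R) :
  eudist p q <= `|p.1 - q.1| + `|p.2 - q.2|.
Proof.
have xy0 : 0 <= `|p.1 - q.1| + `|p.2 - q.2| by rewrite addr_ge0.
rewrite -(@ler_pXn2r _ 2) ?nnegrE ?sqrtr_ge0 // sqr_sqrtr; last first.
  by rewrite addr_ge0 // -expr2 sqr_ge0.
rewrite /dotp sqrrD !real_normK ?num_real // /= -!expr2.
by rewrite addrAC lerDl mulrn_wge0 // mulr_ge0.
Qed.

(** This segment is the limit of the vertical diagonals of the rhombi, which lie over
    [x = pi / (2 n)] and span the heights [pi / 2 - pi] to [pi / 2 + pi]. *)
Lemma segment_vertical (R : realType) :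
  segment (0, - (pi / 2)) (0, 3 * pi / 2) = [set 0 : R] `*` `[- (pi / 2), 3 * pi / 2].
Proof.
have := pi_gt0 R; rewrite /segment; move: pi => w w0.
apply/seteqP; split => [p [t] /= | [x y] /= []].
  rewrite in_itv /= => /andP[t0 t1] <- /=; split.
    by rewrite /GRing.scale /= !mulr0 addr0.
  rewrite in_itv /= /GRing.scale /=; apply/andP; split; nra.
(* The parameter solves [y = - w / 2 + 2 * w * t]. *)
rewrite in_itv /= => -> /andP[y0 y1]; exists ((y + w / 2) / (2 * w)).
  by rewrite in_itv /=; apply/andP; split; rewrite ?ler_pdivlMr ?ler_pdivrMr; lra.
congr pair; first by rewrite /= ?scaler0 addr0.
rewrite /= -![_ *: _]/(_ * _); field; lra.
Qed.

(** The horizontal diagonal has length [2 * pi / n], which serves as the common rate for the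
    distance to the segment, the area and the width. *)
Lemma near_pi_over (R : realType) (e : R) : 0 < e ->
  \forall n \near \oo, (1 <= n)%N /\ 2 * pi / n%:R < e.
Proof.
move=> e0; have pi0 := pi_gt0 R.
near=> n; have n1 : (1 <= n)%N by near: n; exact: nbhs_infty_ge.
split => //; rewrite ltr_pdivrMr ?ltr0n // [e * _]mulrC -ltr_pdivrMr //.
by near: n; exact: nbhs_infty_gtr.
Unshelve. all: by end_near.
Qed.

Lemma cvg_pi_over (R : realType) : 2 * pi / n%:R @[n --> \oo] --> (0 : R).
Proof.
apply/cvgrPdist_lt => e e0; apply: filterS (near_pi_over e0) => n [n1 ne].
by rewrite sub0r normrN ger0_norm // divr_ge0 // mulr_ge0 // pi_ge0.
Qed.

Lemma Q_sub_box (R : realType) (n : nat) : (1 <= n)%N ->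
  Q R n `<=` `[- (pi / 2 / n%:R), 3 * pi / 2 / n%:R] `*` `[- (pi / 2), 3 * pi / 2].
Proof.
move=> n1 p /QP[a b c d]; have n0 : 0 < n%:R :> R by rewrite ltr0n.
split; rewrite /= in_itv /=; apply/andP; split; rewrite -?mulNr ?ler_pdivrMr ?ler_pdivlMr //; lra.
Qed.

Lemma Q_collapse (R : realType) :
  collapse_to (Q R) (segment (0, - (pi / 2)) (0, 3 * pi / 2)).
Proof.
move=> e e0; have pi0 := pi_gt0 R.
apply: filterS (near_pi_over e0) => n [n1 ne].
have n0 : 0 < n%:R :> R by rewrite ltr0n.
have n1' : 1 <= n%:R :> R by rewrite ler1n.
rewrite segment_vertical; split=> p.
  (* A point of the rhombus is compared with the point of the segment at the same height. *)
  move=> /(Q_sub_box n1)[] /= a b; exists (0, p.2) => //.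
  apply: le_lt_trans (eudist_le _ _) _; rewrite /= subrr normr0 addr0 subr0.
  apply: le_lt_trans ne; move: a; rewrite in_itv /= => /andP[a1 a2].
  rewrite ler_norml -!mulNr; apply/andP; split.
    by apply: le_trans a1; rewrite -mulNr ler_pM2r ?invr_gt0 //; lra.
  by apply: le_trans a2 _; rewrite ler_pM2r ?invr_gt0 //; lra.
case: p => x y [] /= -> ; rewrite in_itv /= => /andP[y1 y2].
have yb : `|y - pi / 2| <= pi by rewrite ler_norml; apply/andP; split; lra.
(* The end points of the diagonal are not in the open rhombus, so heights are contracted towards the
   center by [1 - 1 / n]. This costs at most [pi / n] vertically, besides the horizontal shift
   [pi / (2 n)]. *)
exists (Qcenter R n + (0, (1 - n%:R^-1) * (y - pi / 2))).
  apply: Q_from_center => //; rewrite mulr0 normr0 add0r normrM.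
  rewrite ger0_norm ?subr_ge0 ?invf_le1 //.
  have : 0 < n%:R^-1 :> R by rewrite invr_gt0.
  have : 0 <= 1 - n%:R^-1 :> R by rewrite subr_ge0 invf_le1.
  by move=> h1 h2; nra.
apply: le_lt_trans (eudist_le _ _) _.
apply: le_lt_trans ne.
have -> : (0, y).1 - (Qcenter R n + (0, (1 - n%:R^-1) * (y - pi / 2))).1 = - (pi / 2 / n%:R).
  by rewrite sub0r; congr (- _); rewrite -[RHS]addr0.
have -> : (0, y).2 - (Qcenter R n + (0, (1 - n%:R^-1) * (y - pi / 2))).2 = n%:R^-1 * (y - pi / 2).
  by transitivity (y - (pi / 2 + (1 - n%:R^-1) * (y - pi / 2))); [|ring].
rewrite normrN ger0_norm; last by rewrite !divr_ge0 ?ltW.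
rewrite [`|n%:R^-1 * _|]normrM (ger0_norm (_ : 0 <= n%:R^-1)) ?invr_ge0 ?ltW //.
rewrite [n%:R^-1 * _]mulrC -mulrDl ltr_pM2r ?invr_gt0 //; lra.
Qed.

(** * Area *)

Lemma measurable_Q (R : realType) (n : nat) : measurable (Q R n : set (measurableTypeR R * measurableTypeR R)).
Proof.
have mf1 : measurable_fun setT (fun p : measurableTypeR R * measurableTypeR R => n%:R * p.1 + p.2).
  by apply: measurable_realfun.measurable_funD => //; apply: measurable_realfun.measurable_funM.
have mf2 : measurable_fun setT (fun p : measurableTypeR R * measurableTypeR R => n%:R * p.1 - p.2).
  by apply: measurable_realfun.measurable_funB => //; apply: measurable_realfun.measurable_funM.
rewrite Q_preimage.
apply: measurableI; rewrite -[X in measurable X]setTI.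
- exact: mf1.
- exact: mf2.
Qed.

(** Degenerate rectangles are allowed so that the limit segment is covered too. *)
Lemma area_rectangle (R : realType) (a b c d : R) : a <= b -> c <= d ->
  area (`[a, b] `*` `[c, d]) = ((b - a) * (d - c))%:E.
Proof.
move=> ab cd; rewrite /area product_measure1E //.
transitivity (lebesgue_measure `[a, b] * lebesgue_measure `[c, d])%E => //.
rewrite !lebesgue_measure_itv /= !lte_fin.
have itv (x y : R) : x <= y -> (if (x < y)%R then y%:E - x%:E else 0)%E = (y - x)%:E.
  by rewrite le_eqVlt => /orP[/eqP->|->//]; rewrite ltxx subrr.
by rewrite !itv.
Qed.

Lemma area_segment (R : realType) :
  area (segment (0, - (pi / 2)) (0, 3 * pi / 2) : set (R * R)) = 0%E.
Proof.
rewrite segment_vertical -set_itv1 area_rectangle ?subrr ?mul0r //.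
have := pi_gt0 R; lra.
Qed.

(** The area is squeezed between 0 and that of the bounding box spanned by the diagonals,
    [2 * pi / n] by [2 * pi]. *)
Lemma area_Q_cvg (R : realType) : (area (Q R n) @[n --> \oo] --> 0%E).
Proof.
have pi0 := pi_gt0 R.
apply: (@squeeze_cvge _ _ _ _ (cst 0%E) _ (fun n => (2 * pi / n%:R * (2 * pi))%:E)).
- near=> n; have n1 : (1 <= n)%N by near: n; exact: nbhs_infty_ge.
  rewrite measure_ge0 /=.
  pose box : set (R * R) := `[- (pi / 2 / n%:R), 3 * pi / 2 / n%:R] `*` `[- (pi / 2), 3 * pi / 2].
  have : (area (Q R n) <= area box)%E.
    apply: le_measure; rewrite ?in_setE.
    - exact: measurable_Q.
    - exact: measurableX.
    - exact: Q_sub_box.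
  move=> /le_trans; apply.
  have n0 : 0 < n%:R^-1 :> R by rewrite invr_gt0 ltr0n.
  rewrite [leLHS]area_rectangle ?lee_fin; last by lra.
    rewrite le_eqVlt; apply/orP; left; apply/eqP; move: pi (lt0r_neq0 n0) => w; rewrite invr_eq0 => nn0; field; exact: nn0.
  by rewrite -mulNr ler_pM2r //; lra.
- exact: cvg_cst.
- apply: cvg_EFin; first by near=> n.
  rewrite -[X in _ --> X](mul0r (2 * pi)); apply: cvgM; last exact: cvg_cst.
  exact: cvg_pi_over.
Unshelve. all: by end_near.
Qed.

(** * Width *)

(** The direction [(n, 1) / r], normal to two parallel sides, attains the width. Conversely, the
    extent [s] in any unit direction [e] is at least that of each diagonal, so [2 pi |e.1| <= n s]
    and [2 pi |e.2| <= s]; summing squares gives [2 pi <= s r]. *)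
Lemma width_Q (R : realType) (n : nat) : (1 <= n)%N ->
  width (Q R n) = (2 * pi / Num.sqrt (1 + n%:R ^+ 2))%:E.
Proof.
move=> n1; have pi0 := pi_gt0 R; have n0 : 0 < n%:R :> R by rewrite ltr0n.
have r2p : 0 < 1 + n%:R ^+ 2 :> R by rewrite ltr_pwDl ?ltr01 // sqr_ge0.
set r := Num.sqrt _; have r0 : 0 < r by rewrite sqrtr_gt0.
have r2 : r ^+ 2 = 1 + n%:R ^+ 2 by rewrite sqr_sqrtr // ltW.
apply/eqP; rewrite eq_le; apply/andP; split.
  apply: ge_ereal_inf; eexists; first (exists (n%:R / r, 1 / r); [|reflexivity]).
    rewrite /dotp /=; move: r2; rewrite !expr2 => r2.
    have -> : n%:R / r * (n%:R / r) + 1 / r * (1 / r) = (1 + n%:R * n%:R) / (r * r).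
      by field; rewrite gt_eqF.
    by rewrite -r2 divff // mulf_neq0 ?gt_eqF.
  apply: ge_ereal_sup => _ [[p q] [/QP [a b _ _] /QP [c d _ _]] <-].
  rewrite lee_fin /dotp /= ler_pdivlMr // mulrDl.
  have -> : n%:R / r * (p - q).1 * r + 1 / r * (p - q).2 * r
            = (n%:R * p.1 + p.2) - (n%:R * q.1 + q.2).
    rewrite -[(p - q).1]/(p.1 - q.1) -[(p - q).2]/(p.2 - q.2).
    by field; rewrite gt_eqF.
  lra.
apply: le_ereal_inf_tmp => _ [e e1 <-]; set S := [set _ | _ in _].
(* Two points symmetric about the center differ by [(2 a, 2 b)]. *)
have diag a b : n%:R * `|a| + `|b| < pi -> ((2 * (e.1 * a + e.2 * b))%:E <= ereal_sup S)%E.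
  move=> ab; apply: ereal_sup_ubound.
  exists (Qcenter R n + (a, b), Qcenter R n + (- a, - b)).
    by split; apply: Q_from_center; rewrite //= normrM ?normrN (ger0_norm (ltW n0)).
  rewrite /dotp; congr EFin.
  have -> : (Qcenter R n + (a, b) - (Qcenter R n + (- a, - b))).1 = 2 * a.
    by transitivity ((Qcenter R n).1 + a - ((Qcenter R n).1 - a)); [|ring].
  have -> : (Qcenter R n + (a, b) - (Qcenter R n + (- a, - b))).2 = 2 * b.
    by transitivity ((Qcenter R n).2 + b - ((Qcenter R n).2 - b)); [|ring].
  ring.
rewrite leNgt; apply/negP => lt.
(* The trivial pair shows that the supremum is nonnegative; being also below a real number, it is
   finite. *)
have := diag 0 0; rewrite !normr0 !mulr0 !addr0 !mulr0 => /(_ pi0).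
move: lt diag; case: (ereal_sup S) => [s| |] //; rewrite !lte_fin => lt diag; rewrite lee_fin => s0.
have {}diag a b : n%:R * `|a| + `|b| < pi -> 2 * (e.1 * a + e.2 * b) <= s.
  by move=> /diag; rewrite lee_fin.
(* The vertices do not belong to the open rhombus, so the diagonals are shrunk by a factor [th < 1].
   As the midpoint of [s * r / (2 * pi)] and 1, it keeps [s * r < 2 * pi * th] strict. *)
pose th := (1 + s * r / (2 * pi)) / 2.
have pi20 : 0 < 2 * pi :> R by lra.
have srlt : s * r < 2 * pi by rewrite -ltr_pdivlMr.
have th1 : th < 1.
  have : s * r / (2 * pi) < 1 by rewrite ltr_pdivrMr // mul1r.
  by rewrite /th; lra.
have th0 : 0 < th.
  have : 0 <= s * r / (2 * pi) by rewrite divr_ge0 ?mulr_ge0 // ?ltW.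
  by rewrite /th; lra.
have thsr : s * r < 2 * pi * th.
  have -> : 2 * pi * th = (2 * pi + s * r) / 2.
    rewrite /th; have := lt0r_neq0 pi0; move: pi => w w0; field; exact: w0.
  lra.
have thpi : th * pi < pi by rewrite -[ltRHS]mul1r ltr_pM2r.
clearbody th.
have E1 : 2 * pi * th * `|e.1| <= n%:R * s.
  (* The sign of [e.1] turns the scalar product into an absolute value. *)
  have := diag (Num.sg e.1 * (th * pi / n%:R)) 0.
  rewrite normr0 addr0 mulr0 addr0 => H.
  have : 2 * (e.1 * (Num.sg e.1 * (th * pi / n%:R))) <= s.
    have nV : `|n%:R^-1| = n%:R^-1 :> R by rewrite gtr0_norm ?invr_gt0.
    apply: H; rewrite !normrM normr_sg (gtr0_norm th0) (gtr0_norm pi0) nV.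
    rewrite mulrCA [n%:R * _]mulrC divfK ?(lt0r_neq0 n0) //.
    by case: (e.1 != 0); rewrite ?mul1r ?mul0r.
  rewrite [e.1 * _]mulrA [e.1 * _]mulrC -normrEsg => {}H.
  have -> : 2 * pi * th * `|e.1| = n%:R * (2 * (`|e.1| * (th * pi / n%:R))).
    by field; rewrite gt_eqF.
  by rewrite ler_pM2l.
have E2 : 2 * pi * th * `|e.2| <= s.
  have := diag 0 (Num.sg e.2 * (th * pi)).
  rewrite normr0 !mulr0 !add0r => H.
  have : 2 * (e.2 * (Num.sg e.2 * (th * pi))) <= s.
    apply: H; rewrite !normrM normr_sg (gtr0_norm th0) (gtr0_norm pi0).
    by case: (e.2 != 0); rewrite ?mul1r ?mul0r.
  rewrite [e.2 * _]mulrA [e.2 * _]mulrC -normrEsg.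
  by congr (_ <= _); ring.
have : (2 * pi * th) ^+ 2 <= (s * r) ^+ 2.
  have e1' : `|e.1| ^+ 2 + `|e.2| ^+ 2 = 1.
    by rewrite !real_normK ?num_real // !expr2.
  rewrite -[leLHS]mulr1 -[X in _ * X]e1' mulrDr -!exprMn [leRHS]exprMn r2.
  have -> : s ^+ 2 * (1 + n%:R ^+ 2) = (n%:R * s) ^+ 2 + s ^+ 2 by ring.
  have h x : 0 <= 2 * pi * th * `|x| :> R by rewrite mulr_ge0 // mulr_ge0 ?ltW.
  have ns : 0 <= n%:R * s by rewrite mulr_ge0.
  by apply: lerD; rewrite ler_pXn2r ?nnegrE.
have h1 : 0 <= 2 * pi * th by rewrite mulr_ge0 ?ltW.
have h2 : 0 <= s * r by rewrite mulr_ge0 // ltW.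
by rewrite ler_pXn2r ?nnegrE // leNgt thsr.
Qed.

Lemma width_Q_decr (R : realType) (n : nat) : (1 <= n)%N -> (width (Q R n.+1) < width (Q R n))%E.
Proof.
move=> n1; have pi0 := pi_gt0 R; rewrite !width_Q // lte_fin.
have pos (k : nat) : 0 < 1 + k%:R ^+ 2 :> R by rewrite ltr_pwDl // sqr_ge0.
rewrite ltr_pM2l ?mulr_gt0 // ltf_pV2 ?posrE ?sqrtr_gt0 // ltr_sqrt //.
by rewrite ltrD2l ltr_pXn2r ?nnegrE // ltr_nat.
Qed.

Lemma width_Q_cvg (R : realType) : (width (Q R n) @[n --> \oo] --> 0%E).
Proof.
have pi0 := pi_gt0 R.
apply: (@squeeze_cvge _ _ _ _ (cst 0%E) _ (fun n => (2 * pi / n%:R)%:E)).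
- near=> n; have n1 : (1 <= n)%N by near: n; exact: nbhs_infty_ge.
  have n0 : 0 < n%:R :> R by rewrite ltr0n.
  rewrite width_Q //; apply/andP; split; rewrite lee_fin.
    by rewrite divr_ge0 ?sqrtr_ge0 // mulr_ge0 // ltW.
  have pos : 0 < 1 + n%:R ^+ 2 :> R by rewrite ltr_pwDl // sqr_ge0.
  rewrite ler_pM2l ?mulr_gt0 // lef_pV2 ?posrE ?sqrtr_gt0 //.
  (* The denominator is at least the square root of [n ^+ 2], which is [n]. *)
  by rewrite -[leLHS]gtr0_norm // -sqrtr_sqr ler_wsqrtr // lerDr.
- exact: cvg_cst.
- by apply: cvg_EFin; [near=> n|exact: cvg_pi_over].
Unshelve. all: by end_near.
Qed.

(** * Assembly of the geometric and spectral claims *)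

Lemma domain_Q (R : realType) (n : nat) : (1 <= n)%N -> domain (Q R n).
Proof.
move=> n1; split; [exact: open_Q|exact: connected_Q|].
by exists (Qcenter R n); exact: Qcenter_in.
Qed.

Theorem mainTheorem4 (R : realType) :
  (forall n : nat, (1 <= n)%N -> domain (Q R n)) /\
  (exists a b : R * R,
     [/\ a <> b, collapse_to (Q R) (segment a b) & area (segment a b) = 0%E]) /\
  (area (Q R n) @[n --> \oo] --> 0%E) /\
  (forall n : nat, (1 <= n)%N -> (width (Q R n.+1) < width (Q R n))%E) /\
  (width (Q R n) @[n --> \oo] --> 0%E) /\
  (forall n : nat, (1 <= n)%N -> (mu1 (Q R n) <= 1%:E)%E).
Proof.
split; first exact: domain_Q.
split.
  exists (0, - (pi / 2)), (0, 3 * pi / 2); split.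
  - case=> E; have := pi_gt0 R; lra.
  - exact: Q_collapse.
  - exact: area_segment.
split; first exact: area_Q_cvg.
split; first exact: width_Q_decr.
by split; [exact: width_Q_cvg|exact: mu1_Q_le1].
Qed.
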